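(* For $\alpha,\beta,\gamma>0$ and $n\ge2$, $$Z_n^{\mathcal{GS}}=\sum_{\theta\in\{0,1\}^2}C_\theta\det(K_\theta),\qquad C_\theta=\tfrac12(-1)^{(\theta_1+n+1)(\theta_2+n+1)}.$$
   Context: $\mathbb{T}_n=(\mathbb{Z}/n\mathbb{Z})^2$, $e^1=(1,0)$, $e^2=(0,1)$, $e^3=\frac12(e^1+e^2)$; mid-edges $\mathbb{M}_n$ = black $\{v+\frac12e^1:v\in\mathbb{T}_n\}$ ⊔ white $\{v+\frac12e^2:v\in\mathbb{T}_n\}$, coordinates mod $n$. A generalised snake configuration is a permutation $\bar\rho$ of $\mathbb{M}_n$ with $\bar\rho(x)\in\{x,x+e^3,x+e^1\}$ ($x$ black), $\bar\rho(x)\in\{x,x+e^3,x+e^2\}$ ($x$ white); $\mathcal{GS}_n$ their set. $S(\bar\rho)$ = number of vertices $v$ with $\bar\rho(v-\frac12e^1)=v+\frac12e^1$ and $\bar\rho(v-\frac12e^2)=v+\frac12e^2$ (crossings); $A,B,C$ = numbers of $x$ with $\bar\rho(x)=x+e^1$, $x+e^2$, $x+e^3$. $Z_n^{\mathcal{GS}}=\sum_{\bar\rho\in\mathcal{GS}_n}(-1)^{S(\bar\rho)}\alpha^{A(\bar\rho)}\beta^{B(\bar\rho)}\gamma^{C(\bar\rho)}$. For $\theta=(\theta_1,\theta_2)\in\{0,1\}^2$ the operator $K_\theta:\mathbb{M}_n\times\mathbb{M}_n\to\mathbb{C}$ is $K_\theta(x,x)=1$; $K_\theta(x,x+e^1)=\alpha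 e^{\pi i\theta_1/n}$ for $x$ black; $K_\theta(x,x+e^2)=\beta e^{\pi i\theta_2/n}$ for $x$ white; $K_\theta(x,x+e^3)=\gamma e^{\pi i(\theta_1+\theta_2)/(2n)}$; and $K_\theta(x,y)=0$ otherwise. *)

(* Defs.v *)
From HB Require Import structures.
From mathcomp Require Import all_boot all_order all_fingroup all_algebra.
From mathcomp Require Import reals trigo.
From mathcomp Require Import complex.
Set Implicit Arguments. Unset Strict Implicit. Unset Printing Implicit Defensive.
Import Order.TTheory GRing.Theory Num.Theory.
Local Open Scope ring_scope.

(* Torus T_n = (Z/nZ)^2 : a vertex (a,b) stands for a e^1 + b e^2. *)
Definition vert (n : nat) := ('I_n * 'I_n)%type.

(* Mid-edges M_n: (false, v) is the black mid-edge v + e^1/2,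
                  (true,  v) is the white mid-edge v + e^2/2. *)
Definition midedge (n : nat) := (bool * vert n)%type.
Definition black {n} (v : vert n) : midedge n := (false, v).
Definition white {n} (v : vert n) : midedge n := (true, v).
Definition is_black {n} (x : midedge n) : bool := ~~ x.1.
Definition is_white {n} (x : midedge n) : bool := x.1.

Definition vadd1 {n} (v : vert n) : vert n := (ordS v.1, v.2).
Definition vadd2 {n} (v : vert n) : vert n := (v.1, ordS v.2).
Definition vsub1 {n} (v : vert n) : vert n := (ord_pred v.1, v.2).
Definition vsub2 {n} (v : vert n) : vert n := (v.1, ord_pred v.2).

Definition madd1 {n} (x : midedge n) : midedge n := (x.1, vadd1 x.2).
Definition madd2 {n} (x : midedge n) : midedge n := (x.1, vadd2 x.2).
(* x + e^3, e^3 = (e^1+e^2)/2: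
   black v+e^1/2 |-> (v+e^1) + e^2/2 (white),
   white v+e^2/2 |-> (v+e^2) + e^1/2 (black). *)
Definition madd3 {n} (x : midedge n) : midedge n :=
  if x.1 then black (vadd2 x.2) else white (vadd1 x.2).

Definition is_gsnake {n} (rho : {perm midedge n}) : bool :=
  [forall x : midedge n,
     if is_black x then [|| rho x == x, rho x == madd3 x | rho x == madd1 x]
     else [|| rho x == x, rho x == madd3 x | rho x == madd2 x]].

Definition crossings {n} (rho : {perm midedge n}) : nat :=
  #|[set v : vert n | (rho (black (vsub1 v)) == black v)
                      && (rho (white (vsub2 v)) == white v)]|.
Definition cntA {n} (rho : {perm midedge n}) : nat := #|[set x | rho x == madd1 x]|.
Definition cntB {n} (rho : {perm midedge n}) : nat := #|[set x | rho x == madd2 x]|.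
Definition cntC {n} (rho : {perm midedge n}) : nat := #|[set x | rho x == madd3 x]|.

Section Complex.
Variable R : realType.
Local Notation C := (R[i]).

Definition expi (t : R) : C := Complex (cos t) (sin t).
Definition rC (a : R) : C := Complex a 0.

Definition Z_GS (n : nat) (alpha beta gamma : R) : C :=
  \sum_(rho : {perm midedge n} | is_gsnake rho)
     (-1) ^+ crossings rho * rC alpha ^+ cntA rho * rC beta ^+ cntB rho
       * rC gamma ^+ cntC rho.

Definition Kop (n : nat) (alpha beta gamma : R) (theta : bool * bool)
    (x y : midedge n) : C :=
  let t1 : R := (nat_of_bool theta.1)%:R in
  let t2 : R := (nat_of_bool theta.2)%:R in
  if y == x then 1
  else if is_black x && (y == madd1 x) then rC alpha * expi (pi * t1 / n%:R)
  else if is_white x && (y == madd2 x) then rC beta * expi (pi * t2 / n%:R)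
  else if y == madd3 x then rC gamma * expi (pi * (t1 + t2) / (2 * n%:R))
  else 0.

Definition Kmx (n : nat) (alpha beta gamma : R) (theta : bool * bool)
    : 'M[C]_(#|{: midedge n}|) :=
  \matrix_(i, j) @Kop n alpha beta gamma theta (enum_val i) (enum_val j).

Definition Ctheta (n : nat) (theta : bool * bool) : C :=
  2^-1 * (-1) ^+ ((nat_of_bool theta.1 + n + 1) * (nat_of_bool theta.2 + n + 1))%N.

End Complex.

(* Main.v *)
Require Import Defs.
From HB Require Import structures.
From mathcomp Require Import all_boot all_order all_fingroup all_algebra.
From mathcomp Require Import reals trigo.
From mathcomp Require Import complex zify ring.
Set Implicit Arguments. Unset Strict Implicit. Unset Printing Implicit Defensive.
Import Order.TTheory GRing.Theory Num.Theory.
Local Open Scope ring_scope.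

(** On the antidiagonal [v1 + v2 = t] the [2n] mid-edges carry the cyclic position
    [p = 2 v1 + [black]], and each step of a snake raises [t] by one and [p] by 0, 1 or 2.
    Without crossings the steps preserve the cyclic order, so numbering the [m] snake points
    of each level by increasing position turns [rho] into
    [(t, i) |-> (t + 1, i + r_t mod m)], with [r_t = 1] exactly when a snake wraps around
    between the levels [t] and [t + 1].  Hence [rho] has the sign
    [(-1) ^ ((m - 1) * sum_t r_t + (n - 1) * m)], where [sum_t r_t] is the horizontal winding
    [h1] and [m = h1 + h2].  Resolving a crossing by a transposition flips the sign and keeps
    [h1] and [h2].  In [det K_theta] the phases multiply to [(-1) ^ (theta1 h1 + theta2 h2)],
    and [C_theta] is the Fourier inversion of the sign [(-1) ^ (h1 h2 + (n + 1)(h1 + h2))]. *)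

(** * Parity of permutations: embeddings, rotations, fibrewise products *)

Lemma odd_perm_embed (A T : finType) (g : A -> T) (s : {perm A}) (r : {perm T}) :
  injective g -> (forall a, r (g a) = g (s a)) ->
  (forall x, x \notin codom g -> r x = x) -> odd_perm r = odd_perm s.
Proof.
move=> g_inj; have [ts -> _] := prod_tpermP s.
elim: ts r => [|[a b] ts IH] r rg rout.
  rewrite big_nil odd_perm1; suff -> : r = 1%g by rewrite odd_perm1.
  apply/permP=> x; rewrite perm1; have [/codomP[a ->]|/rout //] := boolP (x \in codom g).
  by rewrite rg big_nil perm1.
(* Each transposition in a factorisation of [s] is matched by the transposition of the [g]-images,
   so both parities flip together. *)
have -> : r = (tperm (g a) (g b) * (tperm (g a) (g b) * r))%g.
  by rewrite mulgA tperm2 mul1g.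
rewrite big_cons odd_mul_tperm [RHS]odd_mul_tperm (inj_eq g_inj) /=; congr (_ (+) _).
apply: IH => [c|x xP].
  by rewrite permM -inj_tperm // rg big_cons permM tpermK.
rewrite permM tpermD ?rout //; apply: contraNneq xP => <-; exact: codom_f.
Qed.

(** The k-th power sends 0 to k, so there is a single orbit; the parity is [n] minus the number of
    orbits. *)
Lemma odd_perm_ordS n (s : {perm 'I_n}) : s =1 @ordS n -> odd_perm s = odd n.-1.
Proof.
case: n s => [|n] s sE.
  by have -> : s = 1%g; rewrite ?odd_perm1 //; apply/permP=> -[].
have orb (i : 'I_n.+1) : i \in porbit s ord0.
  apply/porbitP; exists i; apply/val_inj.
  suff H k : (k < n.+1)%N -> k = (s ^+ k)%g ord0 :> nat by exact: (H i (ltn_ord i)).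
  elim: k => [|k IH] kn; first by rewrite perm1.
  by rewrite expgSr permM sE /= -IH 1?ltnW // modn_small.
rewrite /odd_perm card_ord; suff -> : porbits s = [set porbit s ord0].
  by rewrite cards1 addbT /= negbK.
apply/setP=> X; rewrite inE; apply/imsetP/eqP=> [[i _ ->]|->]; last by exists ord0.
by apply/esym/eqP; rewrite eq_porbit_mem porbit_sym.
Qed.

Section Fibers.
Variables (A B : finType) (q : A -> {perm B}).

(** Acting only on the fibres over [l] lets the full fibrewise permutation be built one fibre at a
    time, by induction on [l]. *)
Definition fiber_fun (l : seq A) (x : A * B) := (x.1, if x.1 \in l then q x.1 x.2 else x.2).

Lemma fiber_fun_inj l : injective (fiber_fun l).
Proof.
by move=> [a b] [a' b'] [<-] /=; case: ifP => _ => [/perm_inj|] ->.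
Qed.

Lemma odd_perm_fibers (r : {perm A * B}) :
  (forall a b, r (a, b) = (a, q a b)) -> odd_perm r = \big[addb/false]_a odd_perm (q a).
Proof.
move=> rE; have -> : r = perm (@fiber_fun_inj (index_enum A)).
  by apply/permP=> -[a b]; rewrite permE rE /fiber_fun /= mem_index_enum.
elim: (index_enum A) (index_enum_uniq A) => [_|a l IH /= /andP[al ul]].
  rewrite big_nil; suff -> : perm (@fiber_fun_inj [::]) = 1%g by rewrite odd_perm1.
  by apply/permP=> -[a b]; rewrite permE perm1.
have -> : perm (@fiber_fun_inj (a :: l)) =
          (perm (@fiber_fun_inj [:: a]) * perm (@fiber_fun_inj l))%g.
  apply/permP=> -[c b]; rewrite permM !permE /fiber_fun /= !inE.
  by case: eqP => [->|//] /=; rewrite (negPf al).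
rewrite odd_permM big_cons IH //; congr (_ (+) _).
apply: (@odd_perm_embed _ _ (fun b => (a, b))) => [b b' [] //|b|[c b] cP].
  by rewrite permE /fiber_fun /= mem_head.
rewrite permE /fiber_fun inE /=; case: eqP => // ca; case/negP: cP.
by rewrite ca; apply: codom_f.
Qed.

End Fibers.

(** The map is a rotation inside the levels followed by a pure level shift. Each rotated level is an
    [m]-cycle, and the shift consists of [m] cycles of length [n]. *)
Lemma odd_perm_level_rotation n m (r : pred 'I_n) (s : {perm 'I_n * 'I_m}) :
  (forall t i, s (t, i) = (ordS t, if r t then ordS i else i)) ->
  odd_perm s = odd (#|r| * m.-1 + n.-1 * m).
Proof.
move=> sE; pose q t : {perm 'I_m} := if r t then perm (@ordS_inj m) else 1%g.
pose u := perm (@fiber_fun_inj _ _ q (index_enum 'I_n)).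
have -> : s = (u * (u^-1 * s))%g by rewrite mulKVg.
rewrite odd_permM oddD; congr (_ (+) _).
  rewrite (@odd_perm_fibers _ _ q) => [|a b].
    under eq_bigr => t _.
      have -> : odd_perm (q t) = if r t then odd m.-1 else false.
        rewrite /q; case: ifP => _; rewrite ?odd_perm1 //.
        by rewrite (@odd_perm_ordS m) // => i; rewrite permE.
      over.
    rewrite -big_mkcond /= big_const oddM /=.
    rewrite -[#|r|]/#|[pred x | r x]| /=; elim: #|_| => //= k ->.
    by case: (odd m.-1); case: (odd k).
  by rewrite permE /fiber_fun mem_index_enum.
have uE t i : (u^-1 * s)%g (t, if r t then ordS i else i) = (ordS t, if r t then ordS i else i).
  rewrite -sE permM; congr (s _); apply: (@perm_inj _ u); rewrite permKV.
  by rewrite permE /fiber_fun mem_index_enum /= /q; case: ifP; rewrite ?permE.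
have {}uE t i : (u^-1 * s)%g (t, i) = (ordS t, i).
  by have := uE t (if r t then ord_pred i else i); case: (r t); rewrite ?ord_predK.
(* Swapping the two coordinates turns the level shift into a fibrewise permutation. *)
pose v : {perm 'I_m * 'I_n} :=
  perm (@fiber_fun_inj _ _ (fun=> perm (@ordS_inj n)) (index_enum 'I_m)).
have vE i t : v (i, t) = (i, ordS t) by rewrite permE /fiber_fun mem_index_enum /= permE.
rewrite (@odd_perm_embed _ _ (fun x : 'I_m * 'I_n => (x.2, x.1)) v); first last.
- by move=> [t i] /negP[]; apply/codomP; exists (i, t).
- by move=> [i t]; rewrite uE vE.
- by move=> [i t] [i' t'] [-> ->].
rewrite (@odd_perm_fibers _ _ (fun=> perm (@ordS_inj n))) => [|i t]; last by rewrite vE permE.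
rewrite (@odd_perm_ordS n) => [|i]; last by rewrite permE.
rewrite big_const card_ord oddM; elim: m {q u v uE vE s sE} => [|k IH] /=; first by rewrite andbF.
by rewrite IH; case: (odd _); case: (odd k).
Qed.

(* Twice the displacement along [e^1], resp. [e^2], of a legal step from [x] to [y]. *)
Definition hdisp {n} (x y : midedge n) : nat := if y == madd1 x then 2%N else y == madd3 x.
Definition vdisp {n} (x y : midedge n) : nat := if y == madd2 x then 2%N else y == madd3 x.

(** * Level and position coordinates on mid-edges; snake steps in them *)

Section Levels.
Variable k : nat.
Local Notation n := k.+2.
Implicit Types (t : 'I_n) (p q : nat) (x y : midedge n) (rho : {perm midedge n}).

Lemma ordSE (i : 'I_n) : ordS i = i + 1.
Proof. exact: esym (@add_Zp_1 n i). Qed.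

(* [p] is a cyclic position: only its residue modulo [2n] matters. *)
Definition level_at t p : midedge n := (~~ odd p, (p./2%:R, t - p./2%:R)).

Lemma level_at_period t p : level_at t (p + n.*2) = level_at t p.
Proof.
rewrite /level_at oddD odd_double addbF halfD odd_double andbF doubleK add0n natrD.
have -> : k.+2%:R = 0 :> 'I_k.+2 by exact: (@pchar_Zp k.+2).
by rewrite addr0.
Qed.

Lemma level_at_inj t t' p q : (p < n.*2)%N -> (q < n.*2)%N ->
  level_at t p = level_at t' q -> t = t' /\ p = q.
Proof.
move=> pn qn E; have /negb_inj opq := congr1 fst E.
have /= hpq := congr1 (fun x => x.2.1) E; have /= := congr1 (fun x => x.2.2) E.
rewrite hpq => /addIr ->; split=> //.
suff e2 : p./2 = q./2 by rewrite -(odd_double_half p) -(odd_double_half q) opq e2.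
have h (a : nat) : (a < n.*2)%N -> a./2 = (a./2%:R : 'I_n) :> nat.
  by move=> an; rewrite (@val_Zp_nat k.+2 isT) modn_small //; lia.
by rewrite (h p pn) (h q qn) hpq.
Qed.

Lemma level_at_onto x : exists t p, (p < n.*2)%N /\ x = level_at t p.
Proof.
case: x => b [i j]; exists (i + j), (i.*2 + ~~ b)%N; split.
  by have := ltn_ord i; case: b => /=; lia.
rewrite /level_at oddD odd_double halfD odd_double andFb doubleK.
have -> : (~~ b)./2 = 0%N by case: b.
by rewrite addn0 [i%:R]natr_Zp addrC addKr; case: b.
Qed.

Lemma vadd1_neq (v : vert n) : vadd1 v != v.
Proof.
by case: v => i j; rewrite /vadd1 xpair_eqE eqxx andbT ordSE -subr_eq0 addrC addKr oner_eq0.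
Qed.

Lemma vadd2_neq (v : vert n) : vadd2 v != v.
Proof.
by case: v => i j; rewrite /vadd2 xpair_eqE eqxx /= ordSE -subr_eq0 addrC addKr oner_eq0.
Qed.

Lemma vadd12_neq (v : vert n) : vadd1 v != vadd2 v.
Proof.
by case: v => i j; rewrite /vadd1 xpair_eqE /= negb_and ordSE -subr_eq0 addrC addKr oner_eq0.
Qed.

Lemma madd_neqE x :
  ((madd1 x == x) = false) * ((madd2 x == x) = false) * ((madd3 x == x) = false)
  * ((x == madd1 x) = false) * ((x == madd2 x) = false) * ((x == madd3 x) = false)
  * ((madd1 x == madd2 x) = false) * ((madd1 x == madd3 x) = false)
  * ((madd2 x == madd1 x) = false) * ((madd2 x == madd3 x) = false)
  * ((madd3 x == madd1 x) = false) * ((madd3 x == madd2 x) = false).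
Proof.
have E1 : (madd1 x == x) = false.
  by case: x => b v; rewrite xpair_eqE eqxx (negPf (vadd1_neq v)).
have E2 : (madd2 x == x) = false.
  by case: (x) => b v; rewrite xpair_eqE eqxx (negPf (vadd2_neq v)).
have E12 : (madd1 x == madd2 x) = false.
  by case: (x) => b v; rewrite xpair_eqE eqxx (negPf (vadd12_neq v)).
do !split=> //; rewrite 1?[LHS]eq_sym //; by case: (x) => -[] v; rewrite xpair_eqE.
Qed.

Lemma gsnakeP rho : is_gsnake rho -> forall x,
  rho x = x \/ rho x = madd3 x \/ rho x = (if is_black x then madd1 x else madd2 x).
Proof.
move=> /forallP H x; have := H x.
by case: ifP => _ /or3P[/eqP|/eqP|/eqP]; auto.
Qed.

(** Odd positions are black: the step [e^1] moves them by 2, while [e^2] leaves a white position in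
    place. Positions stay unreduced because [level_at] has period [2n] in [p]. *)
Lemma madd_level_at t p :
  madd3 (level_at t p) = level_at (t + 1) p.+1 /\
  (if is_black (level_at t p) then madd1 (level_at t p) else madd2 (level_at t p))
    = level_at (t + 1) (p + (odd p).*2).
Proof.
rewrite /level_at /is_black /madd3 /madd1 /madd2 /vadd1 /vadd2 /black /white /=.
rewrite uphalf_half oddD odd_double addbF halfD odd_double andbF doubleK add0n !ordSE.
case: (odd p) => /=; rewrite ?addn1 ?addn0 ?add0n ?add1n ?addrA; split=> //.
- by rewrite -[in RHS]natr1 opprD addrACA subrr addr0.
- by rewrite -[in RHS]natr1 opprD addrACA subrr addr0.
- by rewrite addrAC.
- by rewrite addrAC.
Qed.

Variable rho : {perm midedge n}.
Hypothesis rhoS : is_gsnake rho.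

Definition disp_at t p := hdisp (level_at t p) (rho (level_at t p)).
Definition moved_at t p := rho (level_at t p) != level_at t p.

Lemma step_level_at t p : moved_at t p ->
  rho (level_at t p) = level_at (t + 1) (p + disp_at t p)
  /\ (odd p <= disp_at t p <= (odd p).+1)%N.
Proof.
rewrite /moved_at /disp_at /hdisp; have [m3 m12] := madd_level_at t p.
have [->|[->|->]] := gsnakeP rhoS (level_at t p); first by rewrite eqxx.
  by rewrite madd_neqE eqxx addn1 m3; case: odd.
move: m12; rewrite /is_black /=; case: (odd p) => /= m12 _; first by rewrite eqxx m12.
by rewrite !madd_neqE m12 /= !addn0.
Qed.

Lemma disp_at_fixed t p : ~~ moved_at t p -> disp_at t p = 0%N.
Proof.
rewrite negbK /disp_at /hdisp => /eqP ->.
by rewrite !madd_neqE.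
Qed.

Hypothesis rho0 : crossings rho = 0%N.

(** A displacement is [odd p] or [odd p + 1], so order can fail only for [p] odd and [q = p + 1].
    There the displacements (1,0) and (2,1) contradict injectivity, and (2,0) is a crossing. Neither
    position is bounded by [2n], so the lemma also compares positions across the wrap. *)
Lemma disp_at_mono t p q : (p < q)%N -> moved_at t p -> moved_at t q ->
  (p + disp_at t p < q + disp_at t q)%N.
Proof.
move=> pq mp mq; have [Ep bp] := step_level_at mp; have [Eq bq] := step_level_at mq.
have [qE|] := eqVneq q p.+1; last first.
  by case: (boolP (odd p)) bp; case: (boolP (odd q)) bq; lia.
have [po|pe] := boolP (odd p); last first.
  by have := bp; have := bq; rewrite qE /= (negPf pe) /=; lia.
have qe : odd q = false by rewrite qE /= po.
have pq_neq : rho (level_at t p) <> rho (level_at t q).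
  by move/perm_inj; rewrite /level_at qE /= po => -[].
rewrite po in bp; rewrite qe in bq; rewrite qE.
have [d1|d1] := eqVneq (disp_at t p) 1%N;
  have [d2|d2] := eqVneq (disp_at t q) 0%N; rewrite -?qE; try lia.
- by exfalso; apply: pq_neq; rewrite Ep Eq d1 d2 qE addn1 addn0.
(* The crossing sits at the vertex carrying positions [q] (white) and [q + 1] (black) of level
   [t + 1]. *)
- exfalso; move/eqP: rho0; rewrite cards_eq0 => /eqP/setP/(_ (level_at (t + 1) q).2).
  rewrite in_set0 inE.
  have d3 : disp_at t p = 2%N by lia.
  have -> : white (level_at (t+1) q).2 = level_at (t+1) q by rewrite /level_at /white qe.
  have -> : black (level_at (t+1) q).2 = level_at (t+1) q.+1.
    by rewrite /level_at /black qe /= uphalf_half qe.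
  have -> : white (vsub2 (level_at (t + 1) q).2) = level_at t q.
    rewrite /level_at /white /vsub2 qe /=; congr (_, (_, _)).
    by rewrite -addrA [1 + _]addrC addrA -ordSE ordSK.
  have -> : black (vsub1 (level_at (t + 1) q).2) = level_at t p.
    rewrite /level_at /black /vsub1 po qE /= uphalf_half po /=; congr (_, (_, _)).
      by rewrite add1n -natr1 -ordSE ordSK.
    by rewrite add1n -natr1 opprD addrACA subrr addr0.
  by rewrite Ep Eq d3 d2 addn0 qE addn2 !eqxx.
- exfalso; apply: pq_neq; rewrite Ep Eq; congr (level_at _ _); lia.
Qed.

End Levels.

(** * Occupied positions of each level; a crossing-free snake as a rotation *)

Section Occupied.
Variable k : nat.
Local Notation n := k.+2.
Implicit Types (t : 'I_n) (p q : nat) (x y : midedge n).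
Variable rho : {perm midedge n}.
Hypothesis rhoS : is_gsnake rho.
Hypothesis rho0 : crossings rho = 0%N.
Local Notation disp_at := (disp_at rho).
Local Notation moved_at := (moved_at rho).
Local Notation step_level_at := (step_level_at rhoS).

Lemma moved_at_step t p : moved_at t p -> moved_at (t + 1) (p + disp_at t p).
Proof.
move=> mp; have [E _] := step_level_at mp.
by rewrite /moved_at -E (inj_eq (@perm_inj _ rho)).
Qed.

Lemma moved_at_period t p : moved_at t (p + n.*2) = moved_at t p.
Proof. by rewrite /moved_at level_at_period. Qed.

Lemma disp_at_period t p : disp_at t (p + n.*2) = disp_at t p.
Proof. by rewrite /disp_at level_at_period. Qed.

Lemma disp_at_top t : moved_at t n.*2.-1 -> (1 <= disp_at t n.*2.-1 <= 2)%N.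
Proof. by case/step_level_at=> _; rewrite /= odd_double. Qed.

(** Position [2n - 2] is white and moves by at most 1; lower positions move by at most 2. Only the
    top position can wrap. *)
Lemma disp_at_no_wrap t p : (p < n.*2.-1)%N -> moved_at t p -> (p + disp_at t p < n.*2)%N.
Proof.
move=> pn /step_level_at[_]; have [->|] := eqVneq p n.*2.-2; last by lia.
by rewrite /= odd_double; lia.
Qed.

(** Surjectivity of [rho] between consecutive levels: the preimage of a moved point is moved, hence
    lies one level below. *)
Lemma moved_at_pred t q : (q < n.*2)%N -> moved_at (t + 1) q ->
  exists p, [/\ (p < n.*2)%N, moved_at t p &
    q = (p + disp_at t p - (if p == n.*2.-1 then n.*2 else 0))%N].
Proof.
move=> qn mq; pose y := level_at (t + 1) q.
have [t0 [p [pn E]]] := level_at_onto (rho^-1 y)%g.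
have mp : moved_at t0 p.
  by rewrite /moved_at -E -(inj_eq (@perm_inj _ rho)) permKV.
have [rp _] := step_level_at mp; have := rp; rewrite -E permKV /y => Eq.
case: (eqVneq p n.*2.-1) => [pE|pE].
  move: (disp_at_top (t := t0)); rewrite -pE => /(_ mp) dp.
  have pd : (p + disp_at t0 p = (p + disp_at t0 p - n.*2) + n.*2)%N by lia.
  rewrite pd level_at_period in Eq.
  have [|/addIr tE qE] := level_at_inj qn _ Eq; first by lia.
  by exists p; rewrite tE pE eqxx -pE.
have pd : (p + disp_at t0 p < n.*2)%N by apply: disp_at_no_wrap => //; lia.
have [/addIr tE qE] := level_at_inj qn pd Eq.
by exists p; rewrite tE (negPf pE) subn0.
Qed.

Definition occ t := [seq p <- iota 0 n.*2 | moved_at t p].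
Definition occ' t := [seq p <- iota 0 n.*2.-1 | moved_at t p].
(* The top position [2n - 1] is black, so a snake there always steps past [2n]. *)
Definition wraps : pred 'I_n := fun t => moved_at t n.*2.-1.

Lemma occ_split t : occ t = if wraps t then rcons (occ' t) n.*2.-1 else occ' t.
Proof.
rewrite /occ; have -> : iota 0 n.*2 = rcons (iota 0 n.*2.-1) n.*2.-1.
  by rewrite -cats1 -(iotaD 0 _ 1) addn1.
by rewrite filter_rcons.
Qed.

Lemma mem_occ t p : (p \in occ t) = moved_at t p && (p < n.*2)%N.
Proof. by rewrite mem_filter mem_iota. Qed.

Lemma mem_occ' t p : (p \in occ' t) = moved_at t p && (p < n.*2.-1)%N.
Proof. by rewrite mem_filter mem_iota. Qed.

(** Both lists are strictly increasing with the same members. A wrapping snake passes from the last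
    entry to the first. *)
Lemma occ_next t :
  let s := [seq (p + disp_at t p)%N | p <- occ' t] in
  occ (t + 1) = if wraps t then (n.*2.-1 + disp_at t n.*2.-1 - n.*2)%N :: s else s.
Proof.
move=> s; apply: (irr_sorted_eq ltn_trans ltnn).
- exact: sorted_filter ltn_trans _ _ (iota_ltn_sorted _ _).
- have ss : sorted ltn s.
    apply: (homo_sorted_in (P := moved_at t) (e := ltn)).
    + by move=> p q mp mq /= pq; apply: (disp_at_mono rhoS rho0).
    + exact: filter_all.
    + exact: sorted_filter ltn_trans _ _ (iota_ltn_sorted _ _).
  case: ifP => // wt; rewrite /= path_min_sorted //; apply/allP=> a /mapP[q].
  rewrite mem_occ' => /andP[mq _] -> {a}.
  (* Shifted by one period, [q] lies above the top position, so monotonicity puts the wrapped image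
     first. *)
  have := disp_at_mono rhoS rho0 (t := t) (p := n.*2.-1) (q := (q + n.*2)%N).
  rewrite moved_at_period disp_at_period => /(_ _ wt mq).
  have dt := disp_at_top wt => dq.
  change (n.*2.-1 + disp_at t n.*2.-1 - n.*2 < q + disp_at t q)%N; lia.
move=> q; rewrite mem_occ; apply/andP/idP=> [[mq qn]|].
  have [p [pn mp ->]] := moved_at_pred qn mq.
  case: eqP => pE.
    by rewrite -pE /wraps -pE mp mem_head.
  have : (p + disp_at t p - 0)%N \in s.
    by rewrite subn0; apply/mapP; exists p; rewrite // mem_occ' mp; lia.
  by case: ifP => // _; rewrite inE => ->; rewrite orbT.
have sP : q \in s -> moved_at (t + 1) q /\ (q < n.*2)%N.
  case/mapP=> p; rewrite mem_occ' => /andP[mp pn] ->.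
  by split; [apply: moved_at_step | apply: disp_at_no_wrap].
case: ifP => // wt; rewrite inE => /orP[/eqP-> | //].
have dt := disp_at_top wt; split; last by lia.
by rewrite -moved_at_period subnK ?moved_at_step //; lia.
Qed.

Lemma size_occ_next t : size (occ (t + 1)) = size (occ t).
Proof.
by rewrite occ_next occ_split; case: ifP; rewrite ?size_rcons /= size_map.
Qed.

Definition nsnakes := size (occ 0).

Lemma size_occ t : size (occ t) = nsnakes.
Proof.
rewrite -[t]natr_Zp; elim: (t : nat) => // i <-.
by rewrite -natr1 size_occ_next.
Qed.

Lemma sum_occ_next t :
  (\sum_(p <- occ t) (p + disp_at t p) = \sum_(q <- occ (t + 1)%R) q + n.*2 * wraps t)%N.
Proof.
rewrite occ_next occ_split; case: ifP => wt; last by rewrite muln0 addn0 big_map.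
have := disp_at_top wt; have : n.*2.-1.+1 = n.*2 by [].
move: n.*2.-1 => top topE dt.
rewrite big_cons big_map -cats1 big_cat big_seq1 muln1 /=; lia.
Qed.

(** The [i]-th moved mid-edge of level [t]; the default 0 is never reached, since every level has
    [nsnakes] occupied positions. *)
Definition snake_point (x : 'I_n * 'I_nsnakes) := level_at x.1 (nth 0%N (occ x.1) x.2).

Lemma snake_point_inj : injective snake_point.
Proof.
move=> [t i] [t' j] E.
have lt_nth (s : 'I_n) (a : 'I_nsnakes) : (nth 0 (occ s) a < n.*2)%N.
  have : nth 0%N (occ s) a \in occ s by rewrite mem_nth ?size_occ.
  by rewrite mem_occ => /andP[].
have [/= tE] := level_at_inj (lt_nth t i) (lt_nth t' j) E; move: E => _.
rewrite -{t'}tE => /eqP; rewrite nth_uniq ?size_occ //; last exact: filter_uniq (iota_uniq _ _).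
by move/eqP/val_inj ->.
Qed.

Lemma snake_point_out x : x \notin codom snake_point -> rho x = x.
Proof.
move=> xP; apply/eqP; apply: contraNT xP => mx.
have [t [p [pn xE]]] := level_at_onto x.
have po : p \in occ t by rewrite mem_occ /moved_at -xE mx.
have pi : (index p (occ t) < nsnakes)%N by rewrite -(size_occ t) index_mem.
by apply/codomP; exists (t, Ordinal pi); rewrite /snake_point /= nth_index.
Qed.

Lemma snake_point_step t (i : 'I_nsnakes) :
  rho (snake_point (t, i)) = snake_point (ordS t, if wraps t then ordS i else i).
Proof.
rewrite /snake_point ordSE /=.
have it : (i < size (occ t))%N by rewrite size_occ.
have mi : moved_at t (nth 0%N (occ t) i).
  by have := mem_nth 0%N it; rewrite mem_occ => /andP[].
have [-> _] := step_level_at mi.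
rewrite occ_next; have sz := size_occ t.
rewrite occ_split in it sz *; case: ifP it sz => wt.
  have dt := disp_at_top wt; have topE : n.*2.-1.+1 = n.*2 by [].
  move: n.*2.-1 dt topE => top dt topE.
  rewrite size_rcons ltnS nth_rcons /= => it sz.
  have [i_lt|i_ge] := ltnP i (size (occ' t)).
    have iS : (i.+1 < nsnakes)%N by lia.
    by rewrite (modn_small iS) /= (nth_map 0%N).
  (* The last snake point is at the top position: its index returns to 0, and its new position is
     reduced by the period [2n]. *)
  have iE : (i : nat) = size (occ' t) by lia.
  have -> : i.+1 = nsnakes by lia.
  rewrite modnn.
  rewrite iE eqxx /= -[RHS]level_at_period subnK //; lia.
by move=> it _; rewrite (nth_map 0%N).
Qed.

Lemma odd_snake : odd_perm rho = odd (#|wraps| * nsnakes.-1 + n.-1 * nsnakes).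
Proof.
pose f (x : 'I_n * 'I_nsnakes) := (ordS x.1, if wraps x.1 then ordS x.2 else x.2).
have f_inj : injective f.
  move=> [t i] [t' j] E; have /ordS_inj /= tE := congr1 fst E.
  by have /= := congr1 snd E; rewrite -tE; case: (wraps t) => [/ordS_inj|] ->.
rewrite -(@odd_perm_level_rotation _ _ wraps (perm f_inj)) => [|t i]; last by rewrite permE.
apply: (odd_perm_embed snake_point_inj) => [[t i]|x]; last exact: snake_point_out.
by rewrite snake_point_step permE.
Qed.

Lemma big_midedge (F : midedge n -> nat) :
  (\sum_x F x = \sum_(t : 'I_n) \sum_(p < n.*2) F (level_at t p))%N.
Proof.
rewrite pair_big /= (reindex (fun x : 'I_n * 'I_n.*2 => level_at x.1 x.2)) //.
apply: onW_bij; apply: inj_card_bij => [[t p] [t' q] /= E|].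
  by have [-> /val_inj->] := level_at_inj (ltn_ord p) (ltn_ord q) E.
by rewrite !card_prod card_bool !card_ord; lia.
Qed.

(** Displacements telescope around the cycle of levels; each wrap leaves a surplus of [2n]. *)
Lemma sum_hdisp : (\sum_x hdisp x (rho x) = n.*2 * #|wraps|)%N.
Proof.
have occE t (F : nat -> nat) :
    (\sum_(p <- occ t) F p = \sum_(p < n.*2 | moved_at t p) F p)%N.
  by rewrite /occ big_filter -(big_mkord (moved_at t) F) /index_iota subn0.
have -> : (\sum_x hdisp x (rho x) = \sum_t \sum_(p <- occ t) disp_at t p)%N.
  rewrite big_midedge; apply: eq_bigr => t _; rewrite occE.
  rewrite [RHS]big_mkcond; apply: eq_bigr => p _.
  by case: ifP => // /negbT /disp_at_fixed.
have : (\sum_t \sum_(p <- occ t) (p + disp_at t p)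
        = \sum_t (\sum_(q <- occ (t + 1)%R) q + n.*2 * wraps t))%N.
  by apply: eq_bigr => t _; apply: sum_occ_next.
move: n.*2 => N; under eq_bigr do rewrite big_split /=.
rewrite !big_split /= -big_distrr /=.
(* Shifting [t] by one identifies the two sums of positions, which then cancel. *)
rewrite -(reindex_inj (addIr (1%R : 'I_n)) (P := xpredT) (F := fun t => \sum_(q <- occ t) q)%N).
move/addnI ->; congr (_ * _)%N; rewrite -sum1_card [RHS]big_mkcond /=.
by apply: eq_bigr => t _; rewrite -topredE /=; case: (wraps t).
Qed.

Lemma card_moved : #|[pred x | rho x != x]| = (n * nsnakes)%N.
Proof.
have -> : (n * nsnakes)%N = #|{: 'I_n * 'I_nsnakes}| by rewrite card_prod !card_ord.
rewrite -(card_codom snake_point_inj).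
apply: eq_card => x; rewrite inE; apply/idP/idP => [|/codomP[[t i] ->]].
  by apply: contraR => /snake_point_out ->.
rewrite snake_point_step (inj_eq snake_point_inj) xpair_eqE negb_and ordSE.
by rewrite -subr_eq0 addrC addKr oner_eq0.
Qed.

End Occupied.

(** * Sign of a snake configuration in terms of crossings and windings *)

Section Sign.
Variable k : nat.
Local Notation n := k.+2.
Implicit Types (rho : {perm midedge n}) (v : vert n) (x : midedge n).

(** A straight step gives 2 + 0 and a diagonal one 1 + 1; summed over all mid-edges, this yields
    [h1 + h2 = m]. *)
Lemma hvdisp_gsnake rho x : is_gsnake rho ->
  (hdisp x (rho x) + vdisp x (rho x) = (rho x != x).*2)%N.
Proof.
move=> rhoS; rewrite /hdisp /vdisp; have [->|[->|->]] := gsnakeP rhoS x.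
- by rewrite !madd_neqE eqxx.
- by rewrite !madd_neqE eqxx.
by case: is_black; rewrite eqxx !madd_neqE.
Qed.

Lemma odd_gsnake_noncrossing rho : is_gsnake rho -> crossings rho = 0%N ->
  exists h1 h2 : nat, [/\ (\sum_x hdisp x (rho x) = n.*2 * h1)%N,
    (\sum_x vdisp x (rho x) = n.*2 * h2)%N &
    odd_perm rho = odd (h1 * h2 + n.+1 * (h1 + h2))].
Proof.
move=> rhoS rho0; set h := #|wraps rho|; set m := nsnakes rho.
have sH : (\sum_x hdisp x (rho x) = n.*2 * h)%N := sum_hdisp rhoS rho0.
have sHV : (\sum_x hdisp x (rho x) + \sum_x vdisp x (rho x) = n.*2 * m)%N.
  rewrite -big_split /= (eq_bigr _ (fun x _ => hvdisp_gsnake x rhoS)).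
  rewrite -doubleMl -(card_moved rhoS rho0) -sum1_card -[RHS]muln2 big_distrl [RHS]big_mkcond /=.
  by apply: eq_bigr => x _; rewrite inE; case: eqP.
have hm : (h <= m)%N by rewrite -(@leq_pmul2l n.*2) // -sH -sHV leq_addr.
exists h, (m - h)%N; split=> //.
  by apply/eqP; rewrite -(eqn_add2l (n.*2 * h)) -mulnDr subnKC // -sHV sH.
rewrite (odd_snake rhoS rho0) -/h -/m -[in LHS](subnKC hm).
(* As h(h - 1) is even, h(m - 1) has the parity of hd, and n - 1 that of n + 1. The case h = 0 is
   separate because the predecessor of [m] truncates at 0. *)
move: (m - h)%N => d {sH sHV hm m}; case: h => [|h].
  by rewrite /= !mul0n !add0n !oddM /= negbK.
rewrite addSn /= !(oddD, oddM, oddS) /=.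
by case: (odd h); case: (odd d); case: (odd k).
Qed.

(** At a crossing this exchanges the two outgoing mid-edges, replacing two straight steps by two
    turns. *)
Definition uncross rho v : {perm midedge n} := (rho * tperm (black v) (white v))%g.

Lemma vsub1K v : vadd1 (vsub1 v) = v.
Proof. by case: v => i j; rewrite /vadd1 /= ord_predK. Qed.

Lemma vsub2K v : vadd2 (vsub2 v) = v.
Proof. by case: v => i j; rewrite /vadd2 /= ord_predK. Qed.

Section Uncross.
Variables (rho : {perm midedge n}) (v : vert n).
Hypotheses (rhoS : is_gsnake rho) (rho_b : rho (black (vsub1 v)) = black v)
  (rho_w : rho (white (vsub2 v)) = white v).

Lemma uncross_b : uncross rho v (black (vsub1 v)) = madd3 (black (vsub1 v)).
Proof. by rewrite permM rho_b tpermL /madd3 /= vsub1K. Qed.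

Lemma uncross_w : uncross rho v (white (vsub2 v)) = madd3 (white (vsub2 v)).
Proof. by rewrite permM rho_w tpermR /madd3 /= vsub2K. Qed.

Lemma uncross_out x : x != black (vsub1 v) -> x != white (vsub2 v) ->
  uncross rho v x = rho x.
Proof.
move=> xb xw; rewrite permM tpermD // eq_sym.
  by rewrite -rho_b (inj_eq (@perm_inj _ rho)).
by rewrite -rho_w (inj_eq (@perm_inj _ rho)).
Qed.

Lemma uncross_gsnake : is_gsnake (uncross rho v).
Proof.
apply/forallP=> x; have [->|xb] := eqVneq x (black (vsub1 v)).
  by rewrite uncross_b eqxx orbT.
have [->|xw] := eqVneq x (white (vsub2 v)); first by rewrite uncross_w eqxx orbT.
by rewrite uncross_out //; apply: (forallP rhoS).
Qed.

(** Only the two steps into [v] change, and those into any other vertex start at different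
    mid-edges. *)
Lemma crossings_uncross : crossings rho = (crossings (uncross rho v)).+1.
Proof.
rewrite /crossings (cardsD1 v) inE rho_b rho_w !eqxx /= add1n; congr (_.+1).
apply: eq_card => u; rewrite !inE; have [->|uv] := eqVneq u v.
  by rewrite /= uncross_b.
have ub : black (vsub1 u) != black (vsub1 v).
  apply: contraNneq uv => /(congr1 snd)/(congr1 vadd1).
  by rewrite !vsub1K => ->.
have uw : white (vsub2 u) != white (vsub2 v).
  apply: contraNneq uv => /(congr1 snd)/(congr1 vadd2).
  by rewrite !vsub2K => ->.
by rewrite /= !uncross_out.
Qed.

(** The hypothesis holds for [hdisp] (2 + 0 = 1 + 1) and for [vdisp] (0 + 2 = 1 + 1), so both
    windings survive. *)
Lemma sum_uncross (F : midedge n -> midedge n -> nat) :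
  (forall x y, F x (madd1 x) + F y (madd2 y) = F x (madd3 x) + F y (madd3 y))%N ->
  (\sum_x F x (uncross rho v x) = \sum_x F x (rho x))%N.
Proof.
move=> H; have bw : white (vsub2 v) != black (vsub1 v) by [].
rewrite !(bigD1 (black (vsub1 v)) (P := xpredT)) //=.
rewrite !(bigD1 (white (vsub2 v)) (P := fun i => i != black _)) //= !addnA.
rewrite uncross_b uncross_w -H /madd1 /madd2 /= vsub1K vsub2K rho_b rho_w.
by congr (_ + _)%N; apply: eq_bigr => x /andP[xb xw]; rewrite uncross_out.
Qed.

Lemma odd_uncross : odd_perm rho = ~~ odd_perm (uncross rho v).
Proof. by rewrite odd_permM odd_tperm addbT negbK. Qed.

End Uncross.

Lemma odd_gsnake rho : is_gsnake rho ->
  exists h1 h2 : nat, [/\ (\sum_x hdisp x (rho x) = n.*2 * h1)%N,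
    (\sum_x vdisp x (rho x) = n.*2 * h2)%N &
    odd_perm rho = odd (crossings rho + h1 * h2 + n.+1 * (h1 + h2))].
Proof.
elim: {rho}(crossings rho) {-2}rho (erefl (crossings rho)) => [|c IH] rho cE rhoS.
  by rewrite cE; apply: odd_gsnake_noncrossing.
have /set0Pn[v] : [set v : vert n | (rho (black (vsub1 v)) == black v)
   && (rho (white (vsub2 v)) == white v)] != set0 by rewrite -card_gt0 [#|_|]cE.
rewrite inE => /andP[/eqP rb /eqP rw].
have cE' := crossings_uncross rb rw.
have [|h1 [h2 [sH sV sgn]]] := IH (uncross rho v) _ (uncross_gsnake rhoS rb rw).
  by apply/eqP; rewrite -eqSS -cE'; apply/eqP.
exists h1, h2; split; last by rewrite (odd_uncross rho v) sgn cE'.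
- rewrite -sH (sum_uncross rb rw) // => x y.
  by rewrite /hdisp !eqxx !madd_neqE.
- rewrite -sV (sum_uncross rb rw) // => x y.
  by rewrite /vdisp !eqxx !madd_neqE.
Qed.

End Sign.

(** * Leibniz formula over a finite type, and phases *)

Lemma det_fintype (T : finType) (K : comPzRingType) (F : T -> T -> K) :
  \det (\matrix_(i, j) F (enum_val i) (enum_val j) : 'M_#|T|)
  = \sum_(s : {perm T}) (-1) ^+ s * \prod_x F x (s x).
Proof.
have fI (s : {perm T}) : injective (fun i : 'I_#|T| => enum_rank (s (enum_val i))).
  by move=> i j /enum_rank_inj/perm_inj/enum_val_inj.
have gI (s : 'S_#|T|) : injective (fun x => enum_val (s (enum_rank x))).
  by move=> x y /enum_val_inj/perm_inj/enum_rank_inj.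
(* Conjugation by the enumeration identifies permutations of [T] with those of the matrix indices
   and keeps the sign. *)
rewrite /determinant (reindex (fun s => perm (fI s))) /=; last first.
  exists (fun s => perm (gI s)) => s _; apply/permP=> x; rewrite !permE.
    by rewrite !enum_rankK.
  by rewrite !enum_valK.
apply: eq_bigr => s _; congr ((-1) ^+ nat_of_bool _ * _).
  apply/esym/(odd_perm_embed enum_val_inj) => [i|x /negP[]]; first by rewrite permE enum_rankK.
  by rewrite -(enum_rankK x); apply: codom_f.
rewrite [RHS](reindex (@enum_val T T)) /=; last exact: onW_bij (enum_val_bij _).
by apply: eq_bigr => i _; rewrite mxE permE enum_rankK.
Qed.

Section Expi.
Variable R : realType.
Local Notation expi := (@expi R).

Lemma expiD (a b : R) : expi (a + b) = expi a * expi b.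
Proof.
rewrite /expi cosD sinD; apply/eqP.
by rewrite eq_complex /= addrC eqxx /= addrC mulrC eqxx.
Qed.

Lemma expiMn (a : R) m : expi (a *+ m) = expi a ^+ m.
Proof.
elim: m => [|m IH]; last by rewrite mulrS expiD IH exprS.
by rewrite mulr0n expr0 /expi cos0 sin0.
Qed.

Lemma expi_pi (b : bool) : expi (pi * b%:R) = (-1) ^+ b.
Proof.
case: b; rewrite ?mulr1 ?mulr0 /expi ?cospi ?sinpi ?cos0 ?sin0 //.
by rewrite expr1; apply/eqP; rewrite eq_complex /= oppr0 !eqxx.
Qed.

End Expi.

(** * Expansion of the determinants and summation over theta *)

Section Expansion.
Variables (R : realType) (k : nat) (alpha beta gamma : R).
Local Notation n := k.+2.
Implicit Types (rho : {perm midedge n}) (th : bool * bool).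

(** The phase of half a unit step, so that on a snake step the phase of [Kop] is a monomial with
    exponents [hdisp] and [vdisp]. *)
Definition half_phase (b : bool) : R[i] := expi (pi * b%:R / (2 * n%:R)).

Lemma half_phase2 (b : bool) : expi (pi * b%:R / n%:R) = half_phase b ^+ 2.
Proof.
rewrite -expiMn; congr expi; have : n%:R != 0 :> R by rewrite pnatr_eq0.
by move: n%:R => c c0; field.
Qed.

Lemma half_phaseM (a b : bool) :
  expi (pi * (a%:R + b%:R) / (2 * n%:R)) = half_phase a * half_phase b.
Proof. by rewrite -expiD -mulrDl mulrDr. Qed.

Lemma half_phaseX (b : bool) : half_phase b ^+ n.*2 = (-1) ^+ b.
Proof.
rewrite -expiMn -expi_pi; congr expi.
rewrite -[_ *+ _]mulr_natr -mul2n natrM divfK //.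
by rewrite mulf_neq0 ?pnatr_eq0.
Qed.

Definition step_weight (x y : midedge n) : R[i] :=
  (if y == madd1 x then rC alpha else 1) * (if y == madd2 x then rC beta else 1)
  * (if y == madd3 x then rC gamma else 1).

Lemma Kop_gsnake rho th x : is_gsnake rho ->
  Kop alpha beta gamma th x (rho x) = step_weight x (rho x)
    * (half_phase th.1 ^+ hdisp x (rho x) * half_phase th.2 ^+ vdisp x (rho x)).
Proof.
move=> rhoS; rewrite /Kop /step_weight /hdisp /vdisp half_phaseM !half_phase2.
have [->|[->|->]] := gsnakeP rhoS x.
- by rewrite !madd_neqE eqxx !mulr1.
- by rewrite !madd_neqE !andbF eqxx !mul1r.
by rewrite /is_white; case: (boolP (is_black x)); rewrite /is_black => xb;
  rewrite !madd_neqE eqxx ?(negPf xb) ?(negbNE xb) /= ?eqxx !(mulr1, mul1r).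
Qed.

Lemma Kop_not_gsnake rho th : ~~ is_gsnake rho ->
  \prod_x Kop alpha beta gamma th x (rho x) = 0.
Proof.
rewrite negb_forall => /existsP[x xP]; rewrite (bigD1 x) //= [X in X * _](_ : _ = 0) ?mul0r //.
move: xP; rewrite /Kop /is_white /is_black.
by case: (x.1) => /=; rewrite !negb_or => /and3P[/negPf-> /negPf-> /negPf->].
Qed.

Lemma prod_step_weight rho :
  \prod_x step_weight x (rho x)
  = rC alpha ^+ cntA rho * rC beta ^+ cntB rho * rC gamma ^+ cntC rho.
Proof.
have prodE (P : pred (midedge n)) (c : R[i]) :
    \prod_x (if P x then c else 1) = c ^+ #|[set x | P x]|.
  by rewrite -big_mkcond prodr_const; congr (_ ^+ _); apply: eq_card => x; rewrite inE.
by rewrite !big_split /= !prodE.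
Qed.

Lemma Ctheta_sum h1 h2 :
  \sum_th Ctheta R n th * ((-1) ^+ th.1 ^+ h1 * (-1) ^+ th.2 ^+ h2)
  = (-1) ^+ (h1 * h2 + n.+1 * (h1 + h2)) :> R[i].
Proof.
have CE (a b : bool) : Ctheta R n (a, b)
    = 2^-1 * (-1) ^+ (~~ (a (+) odd k) && ~~ (b (+) odd k)).
  by rewrite /Ctheta -signr_odd oddM !oddD /= !oddb negbK addbT addbT.
have SE (a : bool) h : (-1) ^+ a ^+ h = (-1) ^+ (a && odd h) :> R[i].
  by case: a; rewrite ?expr1n ?signr_odd.
rewrite -(pair_bigA _ (fun a b => Ctheta R n (a, b) * ((-1) ^+ a ^+ h1 * (-1) ^+ b ^+ h2))) /=.
rewrite 3!big_bool !CE !SE -[RHS]signr_odd !(oddD, oddM) /=.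
have two : (2 : R[i]) != 0 by rewrite pnatr_eq0.
(* Only the parities of [h1], [h2] and [n] matter; each of the eight cases is a sum of four terms
   1/2 or -1/2. *)
by case: (odd h1); case: (odd h2); case: (odd k) => /=; rewrite ?expr0 ?expr1; field.
Qed.

(** Permutations that are not snakes meet a zero entry; on a snake the phases collect into total
    displacements. *)
Lemma det_Kmx th : \det (Kmx n alpha beta gamma th) =
  \sum_(rho | is_gsnake rho) (-1) ^+ odd_perm rho * \prod_x step_weight x (rho x)
    * (half_phase th.1 ^+ (\sum_x hdisp x (rho x)) * half_phase th.2 ^+ (\sum_x vdisp x (rho x))).
Proof.
rewrite /Kmx det_fintype [LHS](bigID (@is_gsnake n)) /= [X in _ + X]big1 ?addr0.
  apply: eq_bigr => rho rhoS; rewrite -mulrA; congr (_ * _).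
  rewrite !expr_sum -!big_split; apply: eq_bigr => x _; exact: Kop_gsnake.
by move=> rho /Kop_not_gsnake ->; rewrite mulr0.
Qed.

End Expansion.

Theorem theorem3p1 (R : realType) (n : nat) (alpha beta gamma : R) :
  (2 <= n)%N -> 0 < alpha -> 0 < beta -> 0 < gamma ->
  Z_GS n alpha beta gamma =
  \sum_(theta : bool * bool) Ctheta R n theta * \det (Kmx n alpha beta gamma theta).
Proof.
case: n => [|[|k]] // _ _ _ _.
under [RHS]eq_bigr do rewrite det_Kmx big_distrr /=.
rewrite exchange_big; apply: eq_bigr => rho rhoS /=.
have [h1 [h2 [-> -> sgn]]] := odd_gsnake rhoS.
under eq_bigr do rewrite !exprM !half_phaseX mulrCA.
rewrite -big_distrr /= Ctheta_sum prod_step_weight sgn signr_odd -addnA exprD.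
(* The sign of [rho] is (-1)^S e and the sum over theta gives another factor e, so (-1)^S
   remains. *)
set e := (-1) ^+ (h1 * h2 + _); have ee : e * e = 1 by rewrite -expr2 sqrr_sign.
by rewrite -[RHS]mulrA mulrACA ee mulr1 !mulrA.
Qed.
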